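(* Let $n\ge 1$. The character $\chi_{n,1}$ of the action $\tau_{n,1}$ of $S_n$ on $\widehat{\mathrm{PF}}_{n,1}$ can be computed as follows. Let $\pi\in S_n$ have cycle type $\lambda=(\lambda_1,\dots,\lambda_\ell)$, and write $d=\gcd(\lambda_1,\dots,\lambda_\ell)$. Then $$\chi_{n,1}(\pi)=\begin{cases} n^{\ell-2} & d=1,\\ 2n^{\ell-2} & d=2,\ n\equiv 2 \pmod 4,\\ 0&\text{otherwise.}\end{cases}$$ As a consequence, the number $o_{n,1}$ of orbits of the action $\tau_{n,1}$ is given by $$o_{n,1}=\frac{1}{n^2}\sum_{d\mid n}(-1)^{n+d}\mu(n/d)\binom{2d-1}{d},$$ where $\mu$ is the classical Möbius function.
   Context: $S_n$ is the group of permutations of $[n]=\{1,\dots,n\}$; $\pi_i$ denotes the image of $i$ under $\pi$. $\mathbb{Z}_n$ is the set of integers modulo $n$, with representatives in $\{0,\dots,n-1\}$. An integer sequence $(x_1,\dots,x_m)$ is a parking function of length $m$ if its weakly increasing rearrangement $(z_1,\dots,z_m)$ satisfies $0\le z_i\le i-1$ for $i=1,\dots,m$. $\mathrm{PF}_m$ is the set of parking functions of length $m$ ($\mathrm{PF}_0$ consists of the empty sequence). Entries of elements of $\mathrm{PF}_{n-1}$ lie in $\{0,\dots,n-1\}$ and are viewed as elements of $\mathbb{Z}_n$. For $1\le c\le n$ let $$\widehat{\mathrm{PF}}_{n,c}=\Big\{(x_1,\dots,x_n)\in\mathbb{Z}_n^n:\ (x_1,\dots,x_{n-1})\in\mathrm{PF}_{n-1},\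 x_n\equiv c-\sum_{i=1}^{n-1}x_i \pmod n\Big\}.$$ Definition of the $S_n$-action $\tau_{n,c}$ on $\widehat{\mathrm{PF}}_{n,c}$: for $\pi\in S_n$ and $(x_1,\dots,x_n)\in\widehat{\mathrm{PF}}_{n,c}$, by a theorem of Pollak there is exactly one $y\in\mathbb{Z}_n$ such that $(y+x_{\pi_1},\dots,y+x_{\pi_{n-1}})$ (addition modulo $n$) is in $\mathrm{PF}_{n-1}$; for this $y$ one has $(y+x_{\pi_1},\dots,y+x_{\pi_n})\in\widehat{\mathrm{PF}}_{n,c}$, and one sets $\pi\cdot(x_1,\dots,x_n)=(y+x_{\pi_1},\dots,y+x_{\pi_n})$. Products of permutations are read left to right (first $\pi$, then $\sigma$, in $\pi\sigma$), so that this is a left action. The character $\chi_{n,c}(\pi)$ is the number of elements of $\widehat{\mathrm{PF}}_{n,c}$ fixed by $\pi$. *)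

(* Defs.v *)
From mathcomp Require Import all_boot all_order all_algebra all_fingroup.

Set Implicit Arguments.
Unset Strict Implicit.
Unset Printing Implicit Defensive.

Import GRing.Theory.
Local Open Scope ring_scope.

(* Entries are nat, so the condition 0 <= z_i is automatic; z_i <= i - 1 for    *)
(* 1-based i reads nth z i <= i for 0-based i.                                  *)
Definition parking (s : seq nat) : bool :=
  [forall i : 'I_(size s), (nth 0%N (sort leq s) i <= i)%N].

(* From here on n = m.+1 (so n - 1 = m), and Z_n is 'I_m.+1 with its canonical  *)
(* additive group structure, which is the right one for n = 1 too, unlike       *)
(* 'Z_n. The index i : 'I_m.+1 stands for i + 1 in {1, ..., n}.                 *)
Definition word (m : nat) := {ffun 'I_m.+1 -> 'I_m.+1}.

Definition prefix_entry (m : nat) (x : word m) (i : 'I_m) : 'I_m.+1 :=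
  x (widen_ord (leqnSn m) i).

Definition prefix_parking (m : nat) (x : word m) : bool :=
  parking [seq val (prefix_entry x i) | i : 'I_m].

Definition PFhat (m c : nat) : {set word m} :=
  [set x : word m | prefix_parking x
     && (x ord_max == inZp c - \sum_(i < m) prefix_entry x i)].

Definition shift_perm (m : nat) (p : 'S_m.+1) (x : word m) (y : 'I_m.+1) :
  word m := [ffun i => y + x (p i)].

(* By Pollak's theorem there is exactly one y to pick, so the None branch is    *)
(* never taken. The product of 'S_n is also read left to right, hence this is   *)
(* a left action on PFhat m c, whereas the library's {action _ &-> _} are       *)
(* right actions.                                                               *)
Definition tau (m : nat) (p : 'S_m.+1) (x : word m) : word m :=
  if [pick y | prefix_parking (shift_perm p x y)] is Some y
  then shift_perm p x y else x.

Definition chi (m c : nat) (p : 'S_m.+1) : nat :=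
  #|[set x in PFhat m c | tau p x == x]|.

Definition tau_orbit (m : nat) (x : word m) : {set word m} :=
  [set tau p x | p : 'S_m.+1].

Definition num_orbits (m c : nat) : nat :=
  #|[set tau_orbit x | x in PFhat m c]|.

Definition cycle_type (m : nat) (p : 'S_m) : seq nat :=
  sort geq [seq #|pred_of_set C| | C in porbits p].

(* The value at 0 is irrelevant. *)
Definition mobius (n : nat) : int :=
  if all (fun q => logn q n == 1%N) (primes n)
  then (-1) ^+ size (primes n) else 0.

(* Main.v *)
Require Import Defs.
From mathcomp Require Import all_boot all_order all_algebra all_fingroup zify.

(* By Pollak's theorem, PFhat_{n,c} is a set of representatives of the cosets   *)
(* of Z_n(1,...,1) in {x in Z_n^n : sum x = c}, and tau is the permutation of   *)
(* coordinates on these cosets. Hence n chi(p) counts the pairs (x, y) with     *)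
(* sum x = 1 and x o p = x + y. For a given y the solutions of x o p = x + y    *)
(* are n^l in number if y has order dividing d, and there are none otherwise;   *)
(* their sums form a coset of d Z_n, each value being taken equally often. As   *)
(* d divides twice any such sum, only d = 1, y = 0 and d = 2, y = n/2 with n/2  *)
(* odd are left.                                                                *)
(*   For the orbits, Burnside's lemma and Moebius inversion over d reduce the   *)
(* count to the sums of n^l over the p with e | d. If y has order e, this is    *)
(* the number of pairs (p, x) with x o p = x + y, hence n! times the number of  *)
(* y-invariant multisets of size n in Z_n, i.e., of multisets of size n/e in    *)
(* Z_{n/e}.                                                                     *)

Set Implicit Arguments.
Unset Strict Implicit.
Unset Printing Implicit Defensive.

Import Order.TTheory GRing.Theory Num.Theory.
Local Open Scope ring_scope.

(** By [pollak], every coset of the constant words contains exactly one word with parking prefix, so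
    [chi_sum] turns the character into a count over the sets [twist p y]. Translation by one member
    ([card_twist_sum]) reduces each nonempty such set to the words constant on the cycles of p,
    whose sums are equidistributed over the multiples of d ([card_twist_sum0]). Which sums a given y
    allows is controlled by [dvdn_sum_twist], [dvdn_sum_twist2] and [odd_sum_twist]; together they
    give [chi_gcd_weight]. For the orbits, the weight 1, 2 or 0 is written as a sum of signed Möbius
    values over the divisors e of d ([sum_signed_mobius]). After [num_orbits_Burnside] and an
    exchange of sums, what remains is the sum of n^l over the p with e | d. It is evaluated by
    [sum_expn_porbits], where a residue of order e singles out exactly those p. *)

(** * Parking functions and Pollak's theorem *)

(** The sorted entry at index i is at most i exactly when at least i + 1 entries are smaller than i
    + 1; this removes the sorting. *)
Lemma parkingP (s : seq nat) :
  reflect (forall k, k <= size s -> k <= count (fun v => v < k) s)%N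
          (parking s).
Proof.
have st : sorted <=%O (sort leq s) by exact: (sort_sorted leq_total).
have ct k : count (fun v => v < k)%N (sort leq s) = count (fun v => v < k)%N s.
  exact: (seq.permP (permEl (perm_sort leq s))).
apply: (iffP forallP) => [H k lek | H [i lti] /=].
  rewrite leqNgt; apply/negP => ltk.
  have lts : (count (fun v => v < k) s < size s)%N by apply: leq_trans lek.
  have := H (Ordinal lts) => /=; apply/negP; rewrite -ltnNge.
  apply: (leq_trans ltk); rewrite (set_nth_default k) ?size_sort //.
  rewrite -leEnat; apply: (nth_count_ge _ st).
  by rewrite size_sort lts andbT -[X in (_ <= X)%N]ct.
rewrite -ltnS (set_nth_default i.+1) ?size_sort //.
apply: (@nth_count_lt _ nat i.+1 i.+1 _ i st).
by have := H i.+1 lti; rewrite -ct.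
Qed.

Lemma val_subZp (m : nat) (u a : 'I_m.+1) :
  val (u - a) = (if (a <= u)%N then u - a else u + m.+1 - a)%N.
Proof.
rewrite /= modnDmr; case: leqP => au; have := ltn_ord u; have := ltn_ord a.
  move=> ? ?; rewrite addnBA 1?ltnW // addnC -addnBA // modnDl modn_small //.
  lia.
by move=> ? ?; rewrite addnBA 1?ltnW // modn_small //; lia.
Qed.

(** The residues u counted in the first sum form the cyclic interval from a to j, whose indicator is
    [u < j] - [u < a], plus 1 if it wraps past 0. *)
Lemma count_sub_Zp (m : nat) (x : 'I_m -> 'I_m.+1) (a : 'I_m.+1) (j : nat) :
  (j < m.+1)%N ->
  (\sum_(i < m) (val (x i - a)%R < (if a <= j then j - a else j + m.+1 - a))
     + \sum_(i < m) (x i < a)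
   = \sum_(i < m) (x i < j) + (if a <= j then 0 else m))%N.
Proof.
move=> ltj.
have -> : (if a <= j then 0 else m)%N = (\sum_(i < m) ~~ (a <= j)%N)%N.
  by rewrite sum_nat_const card_ord; case: (a <= j)%N; rewrite ?muln0 ?muln1.
rewrite -!big_split; apply: eq_bigr => i _; rewrite val_subZp.
have := ltn_ord (x i); have := ltn_ord a.
by case: (leqP a j); case: (leqP a (x i)) => /=; lia.
Qed.

(** The condition says that a is the first minimum of F j - j. The inequality is strict for j < a
    because an interval that wraps gains m entries but m + 1 positions. *)
Lemma parking_sub_Zp (m : nat) (x : 'I_m -> 'I_m.+1) (a : 'I_m.+1) :
  let F j := (\sum_(i < m) (x i < j))%N in
  parking [seq val (x i - a) | i : 'I_m] =
  [forall j : 'I_m.+1,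
    if (a <= j)%N then (F a + j <= F j + a)%N else (F a + j < F j + a)%N].
Proof.
move=> F; have ct k : count (fun v => v < k)%N [seq val (x i - a) | i : 'I_m]
    = (\sum_(i < m) (val (x i - a)%R < k))%N.
  by rewrite count_map -sum1_count big_mkcond big_enum.
have lta := ltn_ord a.
apply/parkingP/forallP => [H j | H k].
  have ltj := ltn_ord j; have := count_sub_Zp x a ltj; rewrite -ct -!/(F _).
  move: (H (if a <= j then j - a else j + m.+1 - a)%N).
  by rewrite size_map size_enum_ord; case: (leqP a j) => /=; lia.
rewrite size_map size_enum_ord ct => lek.
have [|] := leqP m.+1 (a + k)%N => [ge | lt].
  have ltj : (a + k - m.+1 < m.+1)%N by lia.
  have := count_sub_Zp x a ltj; have := H (Ordinal ltj); rewrite -!/(F _) /=.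
  have -> : (a <= a + k - m.+1 = false)%N by lia.
  have -> : (a + k - m.+1 + m.+1 - a = k)%N by lia.
  lia.
have := count_sub_Zp x a lt; have := H (Ordinal lt); rewrite -!/(F _) /=.
rewrite leq_addr addKn; lia.
Qed.

(* The cycle lemma: the only good [a] is the first point where [F j - j] is     *)
(* minimal.                                                                     *)
Lemma pollak (m : nat) (x : 'I_m -> 'I_m.+1) :
  exists! y, parking [seq val (y + x i) | i : 'I_m].
Proof.
have eqp y : parking [seq val (y + x i) | i : 'I_m] =
             parking [seq val (x i - (- y)) | i : 'I_m].
  by congr parking; apply: eq_map => i; rewrite opprK addrC.
have := parking_sub_Zp x; set F := fun j => (\sum_(i < m) (x i < j))%N.
move=> /= pE.
(* Lexicographic order in one number: [F j - j], shifted by [m.+1] to stay natural, comes first, and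
   [j < m.+1] breaks ties. *)
pose key (j : 'I_m.+1) := ((F j + (m.+1 - j)) * m.+1 + j)%N.
have [a _ mina] := arg_minnP key (erefl : xpredT ord0).
have pa : parking [seq val (x i - a) | i : 'I_m].
  rewrite pE; apply/forallP => j; have := mina j isT; rewrite /key.
  have := ltn_ord j; have := ltn_ord a; case: (leqP a j) => ? ? ? ?; nia.
exists (- a); split=> [|y]; first by rewrite eqp opprK.
rewrite eqp => py; rewrite -[y]opprK; congr (- _); apply/val_inj.
move: pa py; rewrite !pE => /forallP/(_ (- y)) + /forallP/(_ a).
by case: (ltngtP a (- y)) => //=; lia.
Qed.

(** * The action on coset representatives *)

Lemma shift_permM (m : nat) (p q : 'S_m.+1) (x : word m) (y z : 'I_m.+1) :
  shift_perm p (shift_perm q x z) y = shift_perm (p * q)%g x (y + z).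
Proof. by apply/ffunP => i; rewrite !ffunE permM addrA. Qed.

Lemma shift_perm1 (m : nat) (x : word m) : shift_perm 1%g x 0 = x.
Proof. by apply/ffunP => i; rewrite ffunE perm1 add0r. Qed.

Lemma prefix_parking_shift (m : nat) (p : 'S_m.+1) (x : word m) :
  exists! y, prefix_parking (shift_perm p x y).
Proof.
have [y [py uy]] := pollak (fun i : 'I_m => x (p (widen_ord (leqnSn m) i))).
have E z : prefix_parking (shift_perm p x z) =
    parking [seq val (z + x (p (widen_ord (leqnSn m) i))) | i : 'I_m].
  by congr parking; apply: eq_map => i; rewrite /prefix_entry ffunE.
by exists y; split=> [|z]; rewrite E //; apply: uy.
Qed.

Lemma tauE (m : nat) (p : 'S_m.+1) (x : word m) (y : 'I_m.+1) :
  prefix_parking (shift_perm p x y) -> tau p x = shift_perm p x y.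
Proof.
move=> py; have [z [_ uz]] := prefix_parking_shift p x.
rewrite /tau; case: pickP => [t pt | /(_ y)]; last by rewrite py.
by rewrite -(uz _ pt) (uz _ py).
Qed.

Lemma tauP (m : nat) (p : 'S_m.+1) (x : word m) :
  exists2 y, prefix_parking (shift_perm p x y) & tau p x = shift_perm p x y.
Proof.
by have [y [py _]] := prefix_parking_shift p x; exists y => //; apply: tauE.
Qed.

Lemma tau1 (m : nat) (x : word m) : prefix_parking x -> tau 1%g x = x.
Proof. by move=> px; rewrite (@tauE _ _ _ 0) shift_perm1. Qed.

(** Shifts commute with permutations of coordinates, so the two normalising shifts add up to a shift
    that normalises for [p * q]; by uniqueness it is the one that [tau] picks. *)
Lemma tauM (m : nat) (p q : 'S_m.+1) (x : word m) :
  tau p (tau q x) = tau (p * q)%g x.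
Proof.
have [z pz ->] := tauP q x; have [y py ->] := tauP p (shift_perm q x z).
by move: py; rewrite shift_permM => /tauE ->.
Qed.

Lemma Zp_mulrn_card (m : nat) (y : 'I_m.+1) : y *+ m.+1 = 0.
Proof. by rewrite Zp_mulrn; apply/val_inj; rewrite /= modnMl. Qed.

Lemma sum_shift_perm (m : nat) (p : 'S_m.+1) (x : word m) (y : 'I_m.+1) :
  \sum_i shift_perm p x y i = \sum_i x i.
Proof.
rewrite (eq_bigr (fun i => y + x (p i))); last by move=> i _; rewrite ffunE.
rewrite big_split /= sumr_const card_ord Zp_mulrn_card add0r.
by rewrite [RHS](reindex_inj (@perm_inj _ p)).
Qed.

(** The condition on the last coordinate becomes one on the total sum, which neither permutations
    nor shifts change. *)
Lemma in_PFhat (m c : nat) (x : word m) :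
  (x \in PFhat m c) = prefix_parking x && (\sum_i x i == inZp c).
Proof. by rewrite inE big_ord_recr /= addrC eq_sym subr_eq eq_sym. Qed.

Lemma tau_PFhat (m c : nat) (p : 'S_m.+1) (x : word m) :
  x \in PFhat m c -> tau p x \in PFhat m c.
Proof.
have [y py ->] := tauP p x.
by rewrite !in_PFhat sum_shift_perm py => /andP[].
Qed.

(** * Fixed points, Burnside's lemma *)

Definition twist (m : nat) (p : 'S_m.+1) (y : 'I_m.+1) : {set word m} :=
  [set x : word m | [forall i, x (p i) == x i + y]].

Lemma twistP (m : nat) (p : 'S_m.+1) (y : 'I_m.+1) (x : word m) :
  reflect (forall i, x (p i) = x i + y) (x \in twist p y).
Proof. by rewrite inE; apply: 'forall_eqP. Qed.

(** A representative is fixed as soon as its coset is, since the coset has no other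
    representative. *)
Lemma tau_fix (m : nat) (p : 'S_m.+1) (x : word m) :
  prefix_parking x -> (tau p x == x) = [exists y, x \in twist p y].
Proof.
move=> px; apply/eqP/existsP => [tx | [y /twistP xy]].
  have [y _ ty] := tauP p x; exists (- y); apply/twistP => i.
  by rewrite -{2}tx ty ffunE addrAC subrr add0r.
have E : shift_perm p x (- y) = x.
  by apply/ffunP => i; rewrite ffunE xy addrCA addNr addr0.
by rewrite (@tauE _ _ _ (- y)) E.
Qed.

(** Each word of E has one shift with parking prefix, and each word with parking prefix is reached
    in this way from n words. *)
Lemma card_shift_closed (m : nat) (E : {set word m}) :
  (forall x y, x \in E -> shift_perm 1 x y \in E) ->
  (#|E| = m.+1 * #|[set x in E | prefix_parking x]|)%N.
Proof.
move=> shE.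
have EP x y : (shift_perm 1 x y \in E) = (x \in E).
  apply/idP/idP => [/(@shE _ (- y))|/(@shE _ y)] //.
  by rewrite shift_permM addNr mul1g shift_perm1.
transitivity (\sum_(x in E) \sum_(y | prefix_parking (shift_perm 1 x y)) 1)%N.
  rewrite -sum1_card; apply: eq_bigr => x _.
  have [y [py uy]] := prefix_parking_shift 1 x.
  rewrite (big_pred1 y) // => z; apply/idP/eqP => [/uy // | ->] //.
transitivity (\sum_(y : 'I_m.+1) #|[set x in E | prefix_parking x]|)%N;
  last by rewrite sum_nat_const card_ord.
rewrite (exchange_big_dep xpredT) //=.
apply: eq_bigr => y _; rewrite sum1_card.
rewrite -(card_imset _ (can_inj (f := fun x : word m => shift_perm 1 x y)
  (g := fun x => shift_perm 1 x (- y)) _)); last first.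
  by move=> x; rewrite shift_permM addNr mul1g shift_perm1.
apply: eq_card => x; apply/imsetP/idP => [[z]|].
  by rewrite unfold_in !inE => /andP[zE pz] ->; rewrite EP zE.
rewrite inE => /andP[xE px]; exists (shift_perm 1 x (- y)).
  by rewrite unfold_in EP xE shift_permM mul1g subrr shift_perm1.
by rewrite shift_permM mul1g subrr shift_perm1.
Qed.

(** Being in some [twist p y] and having sum c are both invariant under shifts, so
    [card_shift_closed] applies. Moreover x determines y as x (p i) - x i. *)
Lemma chi_sum (m c : nat) (p : 'S_m.+1) :
  (m.+1 * chi c p =
   \sum_y #|[set x in twist p y | (\sum_i x i == inZp c)%R]|)%N.
Proof.
pose E := [set x : word m |
  [exists y, x \in twist p y] && (\sum_i x i == inZp c)].
have -> : chi c p = #|[set x in E | prefix_parking x]|.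
  apply: eq_card => x; rewrite inE in_PFhat [RHS]inE [x \in E]inE.
  by case px : (prefix_parking x); rewrite ?andbF //= tau_fix // andbT andbC.
rewrite -card_shift_closed => [|x y]; last first.
  rewrite !inE sum_shift_perm => /andP[/existsP[z /twistP xz] ->].
  rewrite andbT; apply/existsP; exists z; apply/twistP => i.
  by rewrite !ffunE !perm1 xz addrA.
rewrite -sum1_card.
transitivity (\sum_(x in E) \sum_(y | x \in twist p y) 1)%N.
  apply: eq_bigr => x; rewrite inE => /andP[/existsP[y xy] _].
  rewrite (big_pred1 y) // => z; apply/idP/eqP => [/twistP xz | ->] //.
  by apply: (addrI (x ord0)); rewrite -xz; move/twistP: xy.
rewrite (exchange_big_dep xpredT) //=; apply: eq_bigr => y _; rewrite sum1_card.
apply: eq_card => x; rewrite [RHS]inE unfold_in [x \in E]inE.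
case xy: (x \in twist p y); rewrite ?andbF //= andbT.
by case: existsP => // -[]; exists y.
Qed.

(** Inverting p turns the left action [tau] into a right one; this changes neither the orbits nor
    the sum over all p. *)
Lemma num_orbits_Burnside (m c : nat) :
  (num_orbits m c * (m.+1)`! = \sum_(p : 'S_m.+1) chi c p)%N.
Proof.
(* [tau 1] is not the identity off [PFhat m c], hence the restriction. *)
pose to (x : word m) (p : 'S_m.+1) :=
  if x \in PFhat m c then tau p^-1 x else x.
have PP x : x \in PFhat m c -> prefix_parking x by rewrite in_PFhat => /andP[].
have toM x : act_morph to x.
  move=> p q; rewrite /to; case: ifPn => [xP | /negPf->] //.
  by rewrite tau_PFhat // tauM invMg.
have to1 : to^~ 1%g =1 id.
  by move=> x; rewrite /to; case: ifP => // /PP px; rewrite invg1 tau1.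
pose A := TotalAction to1 toM.
have actsA : [acts [set: 'S_m.+1], on PFhat m c | A].
  apply/actsP => p _ x /=; rewrite /to; case: ifP => // xP.
  by rewrite tau_PFhat.
have := Frobenius_Cauchy actsA; rewrite cardsT card_Sn => FC.
transitivity (#|[set orbit A [set: 'S_m.+1] x | x in PFhat m c]| * m.+1`!)%N.
  congr (_ * _)%N; congr #|pred_of_set _|; apply: eq_in_imset => x xP.
  apply/setP => z; apply/imsetP/imsetP => -[p _ ->]; exists p^-1%g => //=;
  by rewrite ?inE // /to xP ?invgK.
apply: etrans (esym FC) _; rewrite (reindex_inj invg_inj) /=; apply: eq_big => p; first by rewrite inE.
move=> _; apply: eq_card => x; rewrite 2!inE.
case xP: (x \in PFhat m c); rewrite //= ?inE sub1set inE /= /to xP.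
by rewrite invgK.
Qed.

(** * Solutions of x o p = x + y *)

Lemma twist_iter (m : nat) (p : 'S_m.+1) (y : 'I_m.+1) (x : word m) k i :
  x \in twist p y -> x (iter k p i) = x i + y *+ k.
Proof.
move=> /twistP xy; elim: k => [|k IHk]; first by rewrite addr0.
by rewrite iterS xy IHk mulrSr addrA.
Qed.

Lemma twist_order (m : nat) (p : 'S_m.+1) (y : 'I_m.+1) (x : word m) i :
  x \in twist p y -> y *+ #|porbit p i| = 0.
Proof.
move=> /(twist_iter #|porbit p i| i); rewrite iter_porbit => /esym/eqP.
by rewrite -subr_eq0 addrAC subrr add0r => /eqP.
Qed.

(** Along the cycle starting at r the values are the arithmetic progression x r + k y. *)
Lemma porbit_sum (m : nat) (p : 'S_m.+1) (y : 'I_m.+1) (x : word m) r :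
  x \in twist p y ->
  \sum_(i in porbit p r) x i =
    x r *+ #|porbit p r| + y *+ 'C(#|porbit p r|, 2).
Proof.
move=> xy; rewrite (eq_bigl _ _ (porbit_traject p r)).
rewrite -big_uniq ?uniq_traject_porbit //= (big_nth r) size_traject big_nat.
rewrite (eq_bigr (fun k => x r + y *+ k)) => [|k /andP[_ ltk]]; last first.
  by rewrite nth_traject // (twist_iter _ _ xy).
by rewrite -big_nat big_split /= sumr_const_nat subn0 sumrMnr bin2_sum.
Qed.

Lemma sum_porbits (R : nmodType) (I : finType) (p : {perm I}) (F : I -> R) :
  \sum_i F i = \sum_(C in porbits p) \sum_(i in C) F i.
Proof.
transitivity (\sum_(i in I) F i); first by apply: eq_bigl.
rewrite (partition_big_imset (porbit p)) /=; apply: eq_bigr => C.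
case/imsetP => r _ ->; apply: eq_bigl => i.
by rewrite eq_porbit_mem.
Qed.

Lemma sum_card_porbits (I : finType) (p : {perm I}) :
  (\sum_(C in porbits p) #|C| = #|I|)%N.
Proof.
rewrite -sum1_card; apply: etrans (esym (sum_porbits p (fun=> 1%N))).
by apply: eq_bigr => C _; rewrite sum1_card.
Qed.

(** Every cycle gets a base point with value 0, and each application of p adds y; the hypothesis
    makes the values agree when the cycle closes. The base point depends only on the cycle as a set,
    so i and p i share it. *)
Lemma twist_exists (m : nat) (p : 'S_m.+1) (y : 'I_m.+1) :
  (forall i, y *+ #|porbit p i| = 0) -> exists x, x \in twist p y.
Proof.
move=> y0; pose x : word m := [ffun i =>
  if [pick z in porbit p i] is Some z
  then y *+ index i (traject p z #|porbit p i|) else 0].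
exists x; apply/twistP => i; rewrite !ffunE.
have -> : porbit p (p i) = porbit p i by exact: (porbit_perm p 1 i).
case: pickP => [z zi | /(_ i)]; last by rewrite porbit_id.
have Ez : porbit p i = porbit p z by apply/eqP; rewrite eq_porbit_mem porbit_sym.
have : i \in traject p z #|porbit p z| by rewrite -porbit_traject -Ez porbit_id.
rewrite Ez; set L := #|porbit p z| => iL.
have := uniq_traject_porbit p z; rewrite -/L => uL.
have := iL; rewrite -index_mem size_traject; set k := index i _ => ltk.
have Ei : i = iter k p z by rewrite -(nth_traject p ltk) nth_index.
rewrite [in LHS]Ei -iterS -mulrSr; have [eqL | neqL] := eqVneq k.+1 L.
  rewrite eqL [iter _ _ _]iter_porbit y0.
  by case: (L) ltk => //= L' _; rewrite eqxx mulr0n.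
have ltk1 : (k.+1 < L)%N by rewrite ltn_neqAle neqL.
by rewrite -(nth_traject p ltk1) index_uniq ?size_traject.
Qed.

(** These words are constant on cycles, hence are functions on the set of cycles. To be counted by
    [pffun_on], such functions are extended by 0 to all sets. *)
Lemma card_twist0 (m : nat) (p : 'S_m.+1) :
  #|twist p 0| = (m.+1 ^ #|porbits p|)%N.
Proof.
pose g (f : {ffun {set 'I_m.+1} -> 'I_m.+1}) : word m :=
  [ffun i => f (porbit p i)].
have := card_pffun_on (0 : 'I_m.+1) (mem (porbits p)) (mem [set: 'I_m.+1]).
rewrite cardsT card_ord => <-.
have gi : {in pffun_on 0 (porbits p) [set: 'I_m.+1] &, injective g}.
  move=> f1 f2 /pffun_onP[/supportP s1 _] /pffun_onP[/supportP s2 _] /ffunP E.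
  apply/ffunP => C; case: (boolP (C \in porbits p)) => [|CN].
    by case/imsetP => i _ ->; have := E i; rewrite !ffunE.
  by rewrite s1 // s2.
rewrite -(card_in_imset gi); apply: eq_card => x; apply/idP/imsetP.
  move=> xp; pose f : {ffun {set 'I_m.+1} -> 'I_m.+1} := [ffun C : {set 'I_m.+1} =>
    if C \in porbits p then if [pick z in C] is Some z then x z else 0 else 0].
  exists f; first apply/pffun_onP; first split.
  - by apply/supportP => C /negPf CN; rewrite ffunE CN.
  - by move=> C; rewrite inE.
  apply/ffunP => i; rewrite !ffunE imset_f //.
  case: pickP => [z | /(_ i)]; last by rewrite porbit_id.
  rewrite porbit_traject => /trajectP[k _ ->].
  by rewrite (twist_iter _ _ xp) mul0rn addr0.
case=> f _ ->; apply/twistP => i; rewrite !ffunE addr0; congr (f _).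
exact: (porbit_perm p 1 i).
Qed.

Definition twist_sum (m : nat) (p : 'S_m.+1) (y c : 'I_m.+1) : {set word m} :=
  [set x in twist p y | \sum_i x i == c].

(** Adding [x0] is a bijection; the twists add up, and so do the sums. *)
Lemma card_twist_sum (m : nat) (p : 'S_m.+1) (y z c : 'I_m.+1) (x0 : word m) :
  x0 \in twist p z ->
  #|twist_sum p y (c - \sum_i x0 i)| = #|twist_sum p (y + z) c|.
Proof.
move=> /twistP x0P; pose h (x : word m) : word m := [ffun i => x i + x0 i].
have hi : injective h.
  move=> x1 x2 /ffunP E; apply/ffunP => i; have := E i; rewrite !ffunE.
  exact: addIr.
rewrite -(card_imset _ hi); apply: eq_card => x; apply/imsetP/idP => [[t]|].
  rewrite inE => /andP[/twistP ty /eqP tc] ->; rewrite inE; apply/andP; split.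
    by apply/twistP => i; rewrite !ffunE ty x0P addrACA.
  under eq_bigr do rewrite ffunE.
  by rewrite big_split /= tc subrK.
rewrite inE => /andP[/twistP xy /eqP xc].
exists [ffun i => x i - x0 i]; last by apply/ffunP => i; rewrite !ffunE subrK.
rewrite inE; apply/andP; split.
  by apply/twistP => i; rewrite !ffunE xy x0P opprD addrACA addrK.
under eq_bigr do rewrite ffunE.
by rewrite sumrB xc.
Qed.

(** * Sums of the solutions and the gcd of the cycle lengths *)

Definition cycle_gcd (m : nat) (p : 'S_m.+1) : nat :=
  \big[gcdn/0%N]_(k <- cycle_type p) k.

Lemma cycle_gcdE (m : nat) (p : 'S_m.+1) :
  cycle_gcd p = \big[gcdn/0%N]_(C in porbits p) #|C|.
Proof.
rewrite /cycle_gcd (perm_big _ (permEl (perm_sort _ _))) big_map.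
by rewrite big_enum.
Qed.

Lemma size_cycle_type (m : nat) (p : 'S_m.+1) :
  size (cycle_type p) = #|porbits p|.
Proof. by rewrite size_sort size_map cardE. Qed.

Lemma dvdn_cycle_gcdP (m : nat) (p : 'S_m.+1) (D : nat) :
  reflect (forall i, D %| #|porbit p i|)%N (D %| cycle_gcd p)%N.
Proof.
rewrite cycle_gcdE; apply: (iffP (dvdn_biggcdP _ _ _)) => H.
  by move=> i; apply/H/imset_f.
by move=> _ /imsetP[i _ ->].
Qed.

Lemma cycle_gcd_dvd (m : nat) (p : 'S_m.+1) : (cycle_gcd p %| m.+1)%N.
Proof.
rewrite -[X in (_ %| X)%N]card_ord -(sum_card_porbits p).
apply: dvdn_sum => C /imsetP[i _ ->].
by move: i; apply/dvdn_cycle_gcdP.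
Qed.

Lemma dvdn_inZp (m D k : nat) : (D %| m.+1)%N ->
  (D %| (inZp k : 'I_m.+1))%N = (D %| k)%N.
Proof. by move=> Dn; rewrite /= /dvdn modn_dvdm. Qed.

Lemma inZpD (m a b : nat) : inZp (a + b) = inZp a + inZp b :> 'I_m.+1.
Proof. by apply/val_inj; rewrite /= modnDm. Qed.

Lemma inZpM (m a b : nat) : inZp (a * b) = inZp a *+ b :> 'I_m.+1.
Proof. by rewrite Zp_mulrn; apply/val_inj; rewrite /= modnMml. Qed.

Lemma dvdn_Zp_add (m D : nat) (a b : 'I_m.+1) : (D %| m.+1)%N ->
  (D %| a)%N -> (D %| b)%N -> (D %| (a + b)%R)%N.
Proof.
by move=> Dn Da Db; rewrite -[a]valZpK -[b]valZpK -inZpD dvdn_inZp // dvdn_add.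
Qed.

Lemma dvdn_Zp_sum (m D : nat) (I : finType) (P : pred I) (F : I -> 'I_m.+1) :
  (D %| m.+1)%N -> (forall i, P i -> D %| F i)%N ->
  (D %| (\sum_(i | P i) F i)%R)%N.
Proof.
move=> Dn DF; elim/big_rec: _ => [|i a Pi]; first exact: dvdn0.
by apply: dvdn_Zp_add => //; apply: DF.
Qed.

Lemma dvdn_Zp_mulrn (m D : nat) (a : 'I_m.+1) (k : nat) : (D %| m.+1)%N ->
  (D %| a * k)%N -> (D %| (a *+ k)%R)%N.
Proof. by move=> Dn Dak; rewrite Zp_mulrn dvdn_inZp. Qed.

(** A cycle of length L contributes x r L + y C(L, 2), and D divides L; divisibility makes sense for
    residues because D divides n. It serves for y = 0, and for y even with D = 2. *)
Lemma dvdn_sum_twist (m : nat) (p : 'S_m.+1) (y : 'I_m.+1) (x : word m) (D : nat) :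
  (D %| cycle_gcd p)%N -> x \in twist p y ->
  (forall i, D %| y * 'C(#|porbit p i|, 2))%N ->
  (D %| (\sum_i x i)%R)%N.
Proof.
move=> Dp xy Dy; have Dn := dvdn_trans Dp (cycle_gcd_dvd p).
rewrite (sum_porbits p); apply: dvdn_Zp_sum => // _ /imsetP[i _ ->].
rewrite (porbit_sum _ xy); apply: dvdn_Zp_add => //; apply: dvdn_Zp_mulrn => //.
by apply: dvdn_mull; move: i; apply/dvdn_cycle_gcdP.
Qed.

(** Here 2 C(L, 2) = L (L - 1) is a multiple of L. Hence the sum can be 1 only if the gcd divides
    2. *)
Lemma dvdn_sum_twist2 (m : nat) (p : 'S_m.+1) (y : 'I_m.+1) (x : word m) :
  x \in twist p y -> (cycle_gcd p %| ((\sum_i x i) *+ 2)%R)%N.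
Proof.
move=> xy; have dn := cycle_gcd_dvd p.
rewrite -sumrMnl (sum_porbits p); apply: dvdn_Zp_sum => // _ /imsetP[i _ ->].
have dL : (cycle_gcd p %| #|porbit p i|)%N by move: i; apply/dvdn_cycle_gcdP.
rewrite sumrMnl (porbit_sum _ xy) mulrnDl -!mulrnA.
apply: dvdn_Zp_add => //; apply: dvdn_Zp_mulrn => //.
  by rewrite dvdn_mull // dvdn_mulr.
by rewrite [('C(_, 2) * 2)%N]mulnC (mul_bin_left _ 1) bin1 !dvdn_mull.
Qed.

(* The sums of the fixed words form a subgroup of [Z_n] containing the cycle    *)
(* lengths, hence their gcd.                                                    *)
Lemma twist0_sum (m : nat) (p : 'S_m.+1) (c : 'I_m.+1) :
  (cycle_gcd p %| c)%N -> exists2 x, x \in twist p 0 & \sum_i x i = c.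
Proof.
pose P k := exists2 x, x \in twist p 0 & \sum_i x i = inZp k :> 'I_m.+1.
have PM k j : P k -> P (k * j)%N.
  case=> x /twistP xP xk; exists [ffun i => x i *+ j].
    by apply/twistP => i; rewrite !ffunE xP !addr0.
  by under eq_bigr do rewrite ffunE; rewrite sumrMnl xk inZpM.
have PB k j : P (k + j)%N -> P k -> P j.
  case=> x /twistP xP xk [z /twistP zP zk]; exists [ffun i => x i - z i].
    by apply/twistP => i; rewrite !ffunE xP zP !addr0.
  by under eq_bigr do rewrite ffunE; rewrite sumrB xk zk inZpD addrC addKr.
have E0 : inZp 0 = 0 :> 'I_m.+1 by apply/val_inj; rewrite /= mod0n.
have P0 : P 0%N.
  exists [ffun=> 0]; first by apply/twistP => i; rewrite !ffunE addr0.
  by rewrite big1 => [|i _]; rewrite ?E0 ?ffunE.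
have Pg k j : P k -> P j -> P (gcdn k j).
  have [-> | k0] := posnP k; first by rewrite gcd0n.
  (* Bezout: u k = v j + gcd(k, j). *)
  move=> Pk Pj; case: (egcdnP j k0) => u v E _.
  by apply: (PB (v * j)%N); [rewrite -E mulnC; apply: PM | rewrite mulnC; apply: PM].
have Pd : P (cycle_gcd p).
  rewrite cycle_gcdE; elim/big_rec: _ => // C k /imsetP[r _ ->]; apply: Pg.
  (* The indicator of a cycle is constant on cycles and has the cycle length as its sum. *)
  exists [ffun i => inZp (i \in porbit p r)].
    apply/twistP => i; rewrite !ffunE addr0; congr (inZp _).
    rewrite -!eq_porbit_mem; congr (nat_of_bool (_ == _)).
    exact: (porbit_perm p 1 i).
  under eq_bigr do rewrite ffunE.
  rewrite -(big_morph _ (@inZpD m) E0) -sum1_card [in RHS]big_mkcond /=.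
  by congr inZp; apply: eq_bigr => i _; case: (i \in _).
by move=> /dvdnP[j Ej]; rewrite -[c]valZpK Ej mulnC; apply: PM.
Qed.

Lemma card_multiples (m d : nat) : (d %| m.+1)%N ->
  (#|[set c : 'I_m.+1 | d %| c]| * d = m.+1)%N.
Proof.
move=> /dvdnP[q E]; have [q0 d0] : (0 < q /\ 0 < d)%N by lia.
suff -> : #|[set c : 'I_m.+1 | d %| c]%N| = q by [].
pose h (k : 'I_q) : 'I_m.+1 := inord (k * d).
have hE k : h k = (k * d)%N :> nat by rewrite inordK // E ltn_pmul2r.
rewrite -[RHS]card_ord -(card_imset _ (f := h)).
  apply: eq_card => c; rewrite inE; apply/idP/imsetP => [/dvdnP[k Ec] | [k _ ->]].
    have ltk : (k < q)%N by rewrite -(ltn_pmul2r d0) -Ec -E.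
    by exists (Ordinal ltk) => //; apply/val_inj; rewrite /= hE.
  by rewrite hE dvdn_mull.
move=> k j /(congr1 val)/=; rewrite !hE => /eqP.
by rewrite eqn_pmul2r // => /eqP/val_inj.
Qed.

(** The sum maps the n^l words onto the n/d multiples of d, and translation by a word constant on
    cycles shows that all fibres have the same size. *)
Lemma card_twist_sum0 (m : nat) (p : 'S_m.+1) (c : 'I_m.+1) :
  (cycle_gcd p %| c)%N ->
  (m.+1 * #|twist_sum p 0%R c| = cycle_gcd p * m.+1 ^ #|porbits p|)%N.
Proof.
have dn := cycle_gcd_dvd p.
have N0 (c' : 'I_m.+1) : (cycle_gcd p %| c')%N -> #|twist_sum p 0 c'| = #|twist_sum p 0 0|.
  case/twist0_sum => z zP zc; have := card_twist_sum 0 c' zP.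
  by rewrite zc subrr addr0.
move=> /N0->; rewrite -card_twist0.
suff -> : #|twist p 0| =
    (#|[set c : 'I_m.+1 | cycle_gcd p %| c]| * #|twist_sum p 0%R 0%R|)%N.
  by rewrite mulnA [(cycle_gcd p * _)%N]mulnC card_multiples.
rewrite -sum_nat_const -[#|twist p 0|]sum1_card.
rewrite (partition_big (fun x : word m => \sum_i x i)
  [pred c | c \in [set c : 'I_m.+1 | cycle_gcd p %| c]%N]) /=; last first.
  by move=> x xp; rewrite inE; apply: (dvdn_sum_twist _ xp) => // i; rewrite mul0n.
apply: eq_bigr => c'; rewrite inE => /N0 <-; rewrite -sum1_card.
by apply: eq_bigl => x; rewrite [RHS]inE.
Qed.

Lemma mulrn_Zp_eq0 (m : nat) (y : 'I_m.+1) (k : nat) :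
  (y *+ k == 0) = (m.+1 %| y * k)%N.
Proof. by rewrite Zp_mulrn -val_eqE. Qed.

Lemma Zp_double_eq0 (m : nat) (y : 'I_m.+1) :
  y *+ 2 == 0 -> y = 0%N :> nat \/ (y * 2)%N = m.+1.
Proof.
rewrite mulrn_Zp_eq0 => /dvdnP[k]; have := ltn_ord y.
by case: k => [|[|k]]; nia.
Qed.

Lemma twist_cycle_gcd (m : nat) (p : 'S_m.+1) (y : 'I_m.+1) (x : word m) :
  x \in twist p y -> y *+ cycle_gcd p = 0.
Proof.
move=> xy; rewrite cycle_gcdE; elim/big_rec: _ => // C k /imsetP[r _ ->] /eqP yk.
apply/eqP; have := twist_order r xy => /eqP.
move: yk; rewrite !mulrn_Zp_eq0 => yk yC.
by rewrite muln_gcdr dvdn_gcd yC.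
Qed.

Lemma odd_Zp_add (m : nat) (a b : 'I_m.+1) : ~~ odd m.+1 ->
  odd (a + b)%R = odd a (+) odd b.
Proof. by move=> /negPf n2; rewrite /= odd_mod // oddD. Qed.

Lemma odd_sum_twist (m : nat) (p : 'S_m.+1) (y : 'I_m.+1) (x : word m) :
  (2 %| cycle_gcd p)%N -> x \in twist p y -> odd y ->
  odd (\sum_i x i)%R = odd (m.+1./2).
Proof.
move=> d2 xy oy.
have n2 : ~~ odd m.+1.
  by rewrite -dvdn2; apply: dvdn_trans (cycle_gcd_dvd p).
rewrite (sum_porbits p) (big_morph (fun u : 'I_m.+1 => odd u)
  (fun a b => odd_Zp_add a b n2) (erefl (odd (0%R : 'I_m.+1)))).
have L2 C : C \in porbits p -> ~~ odd #|C|.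
  case/imsetP => r _ ->; rewrite -dvdn2; move: r.
  exact/(dvdn_cycle_gcdP p).
have -> : (m.+1./2 = \sum_(C in porbits p) #|C|./2)%N.
  transitivity ((\sum_(C in porbits p) #|C|)./2)%N.
    by rewrite sum_card_porbits card_ord.
  rewrite -[RHS]doubleK -muln2 big_distrl /=; congr (_./2).
  by apply: eq_bigr => C /L2/negPf CN; rewrite muln2 -[LHS]odd_double_half CN.
rewrite (big_morph odd oddD (erefl (odd 0))).
apply: eq_bigr => C CP; have := L2 C CP; case/imsetP: CP => r _ -> oC.
rewrite (porbit_sum _ xy) odd_Zp_add // !Zp_mulrn /= !odd_mod ?(negPf n2) //.
rewrite !oddM oy (negPf oC) andbF /= bin2 -{1}[#|_|]odd_double_half (negPf oC) add0n.
by rewrite -doubleMl doubleK oddM -subn1 oddB ?(negPf oC) ?andbT // lt0n card_porbit_neq0.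
Qed.

Definition gcd_weight (n d : nat) : nat :=
  (if d == 1 then 1 else if (d == 2) && (n == 2 %[mod 4]) then 2 else 0)%N.

Lemma chi_gcd_weight (m : nat) (p : 'S_m.+1) :
  (m.+1 * (m.+1 * chi 1 p) =
   gcd_weight m.+1 (cycle_gcd p) * m.+1 ^ #|porbits p|)%N.
Proof.
have dn := cycle_gcd_dvd p; rewrite chi_sum big_distrr /= -/(twist_sum p _ _).
have EN (x : word m) y : x \in twist_sum p y (inZp 1) ->
    x \in twist p y /\ \sum_i x i = inZp 1.
  by rewrite inE => /andP[? /eqP].
have E0 y : (forall x : word m, x \in twist p y -> \sum_i x i <> inZp 1) ->
    (m.+1 * #|twist_sum p y (inZp 1)| = 0)%N.
  move=> H; rewrite eq_card0 ?muln0 // => x; apply/negP => /EN[xy].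
  exact: H.
rewrite /gcd_weight; case: eqP => [d1 | dN1].
  rewrite (bigD1 0) //= [X in (_ + X)%N]big1 => [|y y0].
    by rewrite card_twist_sum0 ?d1 // addn0.
  apply: E0 => x /twist_cycle_gcd; rewrite d1 => yE _.
  by rewrite -[y]/(y *+ 1) yE eqxx in y0.
have [d2 | dN2] /= := eqVneq (cycle_gcd p) 2%N; last first.
  rewrite mul0n; apply: big1 => y _; apply: E0 => x xy xE.
  have := dvdn_sum_twist2 xy; rewrite xE -inZpM dvdn_inZp // mul1n.
  by move=> /(@dvdn_leq _ 2 isT); have := dvdn_gt0 (ltn0Sn m) dn; lia.
have n2 : (2 %| m.+1)%N by rewrite -d2.
have xodd x : \sum_i x i = inZp 1 :> 'I_m.+1 -> ~~ (2 %| (\sum_(i < m.+1) x i)%R)%N.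
  by move=> ->; rewrite dvdn_inZp.
have evE (y : 'I_m.+1) : (2 %| y)%N -> (m.+1 * #|twist_sum p y (inZp 1)| = 0)%N.
  move=> y2; apply: E0 => x xy /xodd/negP; apply.
  by apply: (dvdn_sum_twist _ xy) => [|i]; rewrite ?d2 ?dvdn_mulr.
have [n4 | nN4] := eqVneq (m.+1 %% 4)%N 2%N; last first.
  rewrite mul0n; apply: big1 => y _.
  have [y2 | yN2] := boolP (y *+ 2 == 0).
    by apply: evE; have := Zp_double_eq0 y2; lia.
  by apply: E0 => x /twist_cycle_gcd; rewrite d2 => y2; rewrite y2 eqxx in yN2.
have lth : (m.+1./2 < m.+1)%N by lia.
pose h := Ordinal lth; have oh : odd h by rewrite /=; lia.
rewrite (bigD1 h) //= [X in (_ + X)%N]big1 => [|y yh].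
  have [i | x xh] := @twist_exists m p h.
    apply/eqP; rewrite mulrn_Zp_eq0 /=.
    have : (2 %| #|porbit p i|)%N by move: i; apply/(dvdn_cycle_gcdP p); rewrite d2.
    by move=> /dvdnP[k ->]; apply/dvdnP; exists k; lia.
  have := card_twist_sum 0 (inZp 1) xh; rewrite add0r addn0 => <-.
  rewrite card_twist_sum0 d2 //.
  have := odd_sum_twist _ xh oh; rewrite d2 => /(_ isT) ox.
  have nodd : ~~ odd m.+1 by rewrite -dvdn2.
  have := odd_Zp_add (inZp 1 - \sum_i x i) (\sum_i x i) nodd.
  rewrite subrK ox; have := dvdn_inZp (m := m) 1 n2; rewrite !dvdn2 => /negbFE->.
  by have -> : odd m.+1./2 = true by []; rewrite addbT => <-.
have [y2 | yN2] := boolP (y *+ 2 == 0).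
  by apply: evE; move: yh; have := Zp_double_eq0 y2; rewrite -val_eqE /=; lia.
by apply: E0 => x /twist_cycle_gcd; rewrite d2 => y2; rewrite y2 eqxx in yN2.
Qed.

Lemma card_twist (m : nat) (p : 'S_m.+1) (y : 'I_m.+1) (x0 : word m) :
  x0 \in twist p y -> #|twist p y| = (m.+1 ^ #|porbits p|)%N.
Proof.
move=> x0P; rewrite -card_twist0.
have E z : #|twist p z| = (\sum_c #|twist_sum p z c|)%N.
  rewrite -sum1_card (partition_big (fun x : word m => \sum_i x i) xpredT) //=.
  apply: eq_bigr => c _; rewrite -sum1_card.
  by apply: eq_bigl => x; rewrite [RHS]inE.
rewrite !E [RHS](reindex_inj (addIr (- \sum_i x0 i))) /=.
by apply: eq_bigr => c _; rewrite (card_twist_sum 0 c x0P) add0r.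
Qed.

Lemma card_twist_inZp (m e k : nat) (p : 'S_m.+1) : m.+1 = (e * k)%N ->
  #|twist p (inZp k)| =
    (if (e %| cycle_gcd p) then m.+1 ^ #|porbits p| else 0)%N.
Proof.
move=> E; have k0 : (0 < k)%N by lia.
have yE j : (inZp k *+ j == 0 :> 'I_m.+1) = (e %| j)%N.
  by rewrite -inZpM -val_eqE /= -/(_ %| _)%N E mulnC dvdn_pmul2l.
case: ifPn => [ep | epN].
  have [i | x /card_twist //] := @twist_exists m p (inZp k).
  by apply/eqP; rewrite yE; move: i; apply/(dvdn_cycle_gcdP p).
apply: eq_card0 => x; apply/negP => /twist_cycle_gcd/eqP.
by rewrite yE (negPf epN).
Qed.

Definition occ (m : nat) (x : word m) (j : 'I_m.+1) : nat := #|[set i | x i == j]|.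

Lemma occ_shift_perm (m : nat) (p : 'S_m.+1) (x : word m) (y j : 'I_m.+1) :
  occ (shift_perm p x y) j = occ x (j - y).
Proof.
rewrite /occ -[RHS](card_imset _ (@perm_inj _ p^-1%g)); apply: eq_card => i.
rewrite inE ffunE; apply/eqP/imsetP => [E | [k]].
  by exists (p i); rewrite ?permK // inE -E addrC addKr.
by rewrite inE => /eqP E ->; rewrite permKV E addrC subrK.
Qed.

Lemma count_occ (m : nat) (x : word m) (j : 'I_m.+1) :
  count_mem j (map x (enum 'I_m.+1)) = occ x j.
Proof. by rewrite count_map -size_filter /occ cardsE cardE enumT. Qed.

Lemma occ_perm (m : nat) (x z : word m) :
  occ x =1 occ z -> exists p, z = shift_perm p x 0.
Proof.
move=> E; have : perm_eq (map z (enum 'I_m.+1)) (mktuple x).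
  by apply/allP => j _ /=; rewrite !count_occ E.
case/tuple_permP => p Ep; exists p; apply/ffunP => i; rewrite ffunE add0r.
have := congr1 (fun s => nth 0 s i) Ep; rewrite (nth_map i) ?size_enum_ord //.
by rewrite nth_ord_enum -tnth_nth !tnth_mktuple.
Qed.

Lemma occ_exists (m : nat) (f : 'I_m.+1 -> nat) :
  (\sum_j f j = m.+1)%N -> exists x : word m, occ x =1 f.
Proof.
move=> fn; pose s := flatten [seq nseq (f j) j | j <- enum 'I_m.+1].
have ss : size s == m.+1.
  rewrite size_flatten /shape -map_comp sumnE big_map big_enum /=.
  by rewrite -[X in _ == X]fn; apply/eqP/eq_bigr => j _; rewrite /= size_nseq.
exists [ffun i => tnth (Tuple ss) i] => j.
have -> : f j = count_mem j s.
  rewrite count_flatten -map_comp sumnE big_map big_enum /= (bigD1 j) //=.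
  rewrite count_nseq /= eqxx mul1n big1 ?addn0 // => i /negPf ij.
  by rewrite /= count_nseq /= ij.
rewrite -count_occ -[s in RHS]/(tval (Tuple ss)) -[in RHS](map_tnth_enum (Tuple ss)).
by congr count; apply: eq_map => i; rewrite ffunE.
Qed.

Lemma sum_occ (m : nat) (x : word m) : (\sum_j occ x j = m.+1)%N.
Proof.
transitivity (\sum_(i in 'I_m.+1) 1)%N; last by rewrite sum1_card card_ord.
rewrite [RHS](partition_big x xpredT) //=; apply: eq_bigr => j _.
rewrite sum1_card; apply: eq_card => i.
by rewrite inE.
Qed.

Definition content (m : nat) (x : word m) : {ffun 'I_m.+1 -> 'I_m.+2} :=
  [ffun j => inord (occ x j)].

Lemma contentE (m : nat) (x : word m) j : content x j = occ x j :> nat.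
Proof.
by rewrite ffunE inordK // ltnS -[X in (_ <= X)%N]card_ord max_card.
Qed.

Lemma eq_content (m : nat) (x z : word m) :
  content x = content z <-> exists p, z = shift_perm p x 0.
Proof.
split=> [E | [p ->]]; first by apply: occ_perm => j; rewrite -!contentE E.
by apply/ffunP => j; apply/val_inj; rewrite /= !contentE occ_shift_perm subr0.
Qed.

Lemma twist_shift (m : nat) (p : 'S_m.+1) (x : word m) (y : 'I_m.+1) :
  (x \in twist p y) = (shift_perm p x 0 == shift_perm 1 x y).
Proof.
apply/twistP/eqP => [xy | /ffunP xy i].
  by apply/ffunP => i; rewrite !ffunE perm1 xy add0r addrC.
by have := xy i; rewrite !ffunE perm1 add0r addrC.
Qed.

(* With [x = x1 s] and [x + y = x1 r], the map [p |-> s r^-1 p s] identifies    *)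
(* the [p] such that [x p = x + y] with the [q] such that [x1 q = x].           *)
Lemma card_twist_perm (m : nat) (x x1 : word m) (y : 'I_m.+1) :
  content x1 = content x -> content x = content (shift_perm 1 x y) ->
  #|[set p | x \in twist p y]| = #|[set q | shift_perm q x1 0 == x]|.
Proof.
move=> E E'; have /eq_content[s xs] := E.
have /eq_content[r xr] := etrans E E'.
pose h (p : 'S_m.+1) : 'S_m.+1 := (s * r^-1 * p * s)%g.
have hi : injective h by move=> p q /mulIg/mulgI.
rewrite -(card_imset _ hi); apply: eq_card => q.
have tw p : (x \in twist p y) = (shift_perm (h p) x1 0 == x).
  rewrite twist_shift xr {1}xs shift_permM addr0.
  apply/eqP/eqP => [/(congr1 (fun t => shift_perm (s * r^-1)%g t 0))|].
    by rewrite !shift_permM !addr0 mulgKV -xs mulgA.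
  move/(congr1 (fun t => shift_perm (r * s^-1)%g t 0)).
  rewrite {1}xs !shift_permM !addr0 mulgKV => <-.
  by rewrite /h !mulgA mulgKV mulgV mul1g.
apply/imsetP/idP => [[p pP ->] | qP].
  have : x \in twist p y by move: pP; rewrite in_set.
  by rewrite tw => hp; rewrite in_set.
have qx : shift_perm q x1 0 == x by move: qP; rewrite in_set.
have hq : h (r * s^-1 * q * s^-1)%g = q.
  by rewrite /h !mulgA mulgKV mulgKV mulgV mul1g.
exists (r * s^-1 * q * s^-1)%g; last by rewrite hq.
by rewrite in_set tw hq.
Qed.

Lemma sum_twist_content (m : nat) (x1 : word m) (y : 'I_m.+1) :
  (forall j, occ x1 (j - y) = occ x1 j) ->
  (\sum_(x | content x == content x1) #|[set p | x \in twist p y]| = m.+1`!)%N.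
Proof.
move=> inv; rewrite -card_Sn.
transitivity (\sum_(x | content x == content x1)
    \sum_(q | shift_perm q x1 0%R == x) 1)%N.
  apply: eq_bigr => x /eqP E; rewrite sum1_card (@card_twist_perm _ _ x1) //.
    by apply: eq_card => q; rewrite inE.
  have occE j : occ x j = occ x1 j by rewrite -!contentE E.
  apply/ffunP => j; apply/val_inj; rewrite /= !contentE occ_shift_perm.
  by rewrite !occE inv.
rewrite (exchange_big_dep xpredT) //= -sum1_card.
apply: eq_big => q; first by rewrite inE.
move=> _; rewrite (big_pred1 (shift_perm q x1 0)) // => x.
apply/idP/eqP => [/andP[_ /eqP->] // | ->]; rewrite eqxx andbT.
by apply/eqP/esym/eq_content; exists q.
Qed.

Definition invariant_contents (m : nat) (y : 'I_m.+1) :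
    {set {ffun 'I_m.+1 -> 'I_m.+2}} :=
  [set f : {ffun 'I_m.+1 -> 'I_m.+2} |
    (\sum_j f j == m.+1)%N && [forall j, f (j - y) == f j]].

Lemma sum_card_twist (m : nat) (y : 'I_m.+1) :
  (\sum_p #|twist p y| = #|invariant_contents y| * m.+1`!)%N.
Proof.
transitivity (\sum_(x : word m) #|[set p | x \in twist p y]|)%N.
  under eq_bigr do rewrite -sum1_card.
  rewrite (exchange_big_dep xpredT) //=; apply: eq_bigr => x _.
  by rewrite sum1_card; apply: eq_card => p; rewrite inE.
rewrite (partition_big (@content m) xpredT) //= -sum_nat_const.
rewrite [RHS]big_mkcond; apply: eq_bigr => f _; case: ifPn => [|fN].
  rewrite inE => /andP[/eqP fn /'forall_eqP finv].
  have [x1 x1E] := occ_exists fn.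
  have -> : f = content x1.
    by apply/ffunP => j; apply/val_inj; rewrite /= contentE x1E.
  by apply: sum_twist_content => j; rewrite !x1E finv.
apply: big1 => x /eqP xf; apply: eq_card0 => p; rewrite inE.
apply: contraNF fN => xp; rewrite inE -xf; apply/andP; split.
  by under eq_bigr do rewrite contentE; rewrite sum_occ.
apply/'forall_eqP => j; apply/val_inj; rewrite /= !contentE.
move: xp; rewrite twist_shift => /eqP E.
by rewrite -(occ_shift_perm 1) -E occ_shift_perm subr0.
Qed.

Lemma sum_modn (e k : nat) (F : nat -> nat) :
  (\sum_(0 <= j < e * k) F (j %% k) = e * \sum_(0 <= i < k) F i)%N.
Proof.
elim: e => [|e IHe]; first by rewrite !mul0n big_nil.
rewrite mulSn (@big_cat_nat _ _ _ k) ?leq_addr //= mulSn; congr (_ + _)%N.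
  by rewrite big_nat [RHS]big_nat; apply: eq_bigr => i /andP[_ ik]; rewrite modn_small.
rewrite -IHe -{1}[k]add0n big_addn addKn; apply: eq_bigr => i _.
by rewrite modnDr.
Qed.

Lemma card_invariant_contents (m e k : nat) : m.+1 = (e * k)%N ->
  #|invariant_contents (inZp k : 'I_m.+1)| = 'C(2 * k - 1, k).
Proof.
case: k => [|k] E; first by lia.
have e0 : (0 < e)%N by lia.
have -> : 'C(2 * k.+1 - 1, k.+1) = 'C(k + k.+1, k).
  have -> : (2 * k.+1 - 1 = k + k.+1)%N by lia.
  by rewrite -[RHS]bin_sub ?leq_addr // addKn.
rewrite -card_ord_partitions.
pose h (t : k.+1.-tuple 'I_k.+2) : {ffun 'I_m.+1 -> 'I_m.+2} :=
  [ffun j : 'I_m.+1 => inord (tnth t (inZp j))].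
have hE t j : h t j = tnth t (inZp j) :> nat.
  by rewrite ffunE inordK //; have := ltn_ord (tnth t (inZp j)); nia.
have ltm (i : 'I_k.+1) : (i < m.+1)%N by have := ltn_ord i; nia.
have hi : injective h.
  move=> t1 t2 /ffunP tt; apply/eq_from_tnth => i; apply/val_inj.
  have := congr1 val (tt (Ordinal (ltm i))); rewrite /= !hE /=.
  by rewrite !valZpK.
have sE (f : nat -> nat) :
    (\sum_(j < m.+1) f (j %% k.+1) = e * \sum_(i < k.+1) f i)%N.
  by rewrite -(big_mkord xpredT (fun j => f (j %% k.+1)%N)) E sum_modn big_mkord.
rewrite -(card_imset _ hi); apply: eq_card => f; rewrite inE.
apply/andP/imsetP => [[/eqP fn /'forall_eqP finv] | [t]].
  have fI q r : f (inZp (q * k.+1 + r)) = f (inZp r).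
    elim: q => // q IHq; rewrite -{}IHq mulSn -addnA -finv; congr (f _).
    by rewrite inZpD addrC addKr.
  have fmod (j : 'I_m.+1) : f j = f (inZp (j %% k.+1)).
    by rewrite -{1}[j]valZpK {1}(divn_eq j k.+1) fI.
  have sk : (\sum_(i < k.+1) f (inZp i) = k.+1)%N.
    apply/eqP; rewrite -(eqn_pmul2l e0) -E -[X in _ == X]fn.
    rewrite -(sE (fun i => f (inZp i))); apply/eqP/eq_bigr => j _.
    by rewrite -fmod.
  have fk (i : 'I_k.+1) : (f (inZp i) < k.+2)%N.
    by rewrite ltnS -[X in (_ <= X)%N]sk (bigD1 i) //= leq_addr.
  exists [tuple inord (f (inZp i)) | i < k.+1].
    rewrite inE big_tuple; apply/eqP; rewrite -[RHS]sk; apply: eq_bigr => i _.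
    by rewrite tnth_mktuple inordK.
  apply/ffunP => j; apply/val_inj; rewrite /= hE tnth_mktuple inordK //.
  by rewrite fmod.
rewrite inE big_tuple => /eqP tk ->; split.
  have -> : (\sum_j h t j = \sum_(j < m.+1) tnth t (inZp (j %% k.+1)))%N.
    apply: eq_bigr => j _; rewrite hE; congr (nat_of_ord (tnth t _)).
    by apply/val_inj; rewrite /= modn_mod.
  rewrite (sE (fun i => tnth t (inZp i))) E; apply/eqP; congr (_ * _)%N.
  by rewrite -[RHS]tk; apply: eq_bigr => i _; rewrite valZpK.
apply/'forall_eqP => j; apply/val_inj; rewrite /= !hE; congr (nat_of_ord (tnth t _)).
rewrite -{2}(subrK (inZp k.+1) j); apply/val_inj; move: (j - _) => u /=.
have kn : (k.+1 %| m.+1)%N by rewrite E dvdn_mull.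
by rewrite modn_dvdm // -(modnDmr u (_ %% _)) modn_dvdm // modnn addn0.
Qed.

Lemma sum_expn_porbits (m e k : nat) : m.+1 = (e * k)%N ->
  (\sum_(p : 'S_m.+1 | e %| cycle_gcd p) m.+1 ^ #|porbits p| =
   'C(2 * k - 1, k) * m.+1`!)%N.
Proof.
move=> E; rewrite -(card_invariant_contents E) -sum_card_twist big_mkcond.
by apply: eq_bigr => p _; rewrite (card_twist_inZp p E).
Qed.

Lemma mobius_sqr (q e : nat) :
  prime q -> (0 < e)%N -> (q ^ 2 %| e)%N -> mobius e = 0.
Proof.
move=> qP e0 qe; rewrite /mobius ifN //; apply/allPn; exists q.
  by rewrite mem_primes qP e0 (dvdn_trans _ qe) // dvdn_exp.
by move: qe; rewrite pfactor_dvdn //; lia.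
Qed.

Lemma mobius_prime_mul (q e : nat) :
  prime q -> (0 < e)%N -> ~~ (q %| e)%N -> mobius (q * e) = - mobius e.
Proof.
move=> qP e0 qe; have q0 := prime_gt0 qP.
have pE : perm_eq (primes (q * e)) (q :: primes e).
  apply: uniq_perm; rewrite /= ?primes_uniq // ?mem_primes ?(negPf qe) ?andbF //.
  by move=> r; rewrite primesM // primes_prime // !inE.
rewrite /mobius (perm_all _ pE) (perm_size pE) /=.
have lq : logn q e = 0%N by apply/eqP; rewrite lognE qP e0 (negPf qe).
rewrite lognM // logn_prime // eqxx lq /=.
have -> : all (fun r => logn r (q * e) == 1%N) (primes e) =
          all (fun r => logn r e == 1%N) (primes e).
  apply: eq_in_all => r; rewrite mem_primes => /and3P[rP _ re].
  rewrite lognM // logn_prime //; have -> // : (r == q) = false by apply: contraNF qe => /eqP<-.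
by case: ifP => _; rewrite ?oppr0 // exprS mulN1r.
Qed.

Lemma sum_divisors_prime (R : zmodType) (F : nat -> R) (q d : nat) :
  prime q -> (0 < d)%N -> (q %| d)%N ->
  (forall e, (0 < e)%N -> (q ^ 2 %| e)%N -> F e = 0) ->
  \sum_(e <- divisors d) F e =
  \sum_(e <- divisors d | ~~ (q %| e)%N) (F e + F (q * e)%N).
Proof.
move=> qP d0 qd F0; have q0 := prime_gt0 qP.
rewrite big_split /= (bigID (fun e => q %| e)%N) /= addrC; congr (_ + _).
rewrite (bigID (fun e => q ^ 2 %| e)%N) /= [X in X + _]big1_seq ?add0r => [|e]; last first.
  rewrite -dvdn_divisors // => /andP[/andP[_ qe] ed].
  by apply: F0 => //; apply: dvdn_gt0 ed.
rewrite -big_filter -[RHS]big_filter -[RHS](big_map (muln q) xpredT F).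
apply: perm_big; apply: uniq_perm; rewrite ?filter_uniq ?divisors_uniq //.
  rewrite map_inj_uniq ?filter_uniq ?divisors_uniq //.
  by move=> a b /eqP; rewrite eqn_pmul2l // => /eqP.
move=> e; rewrite mem_filter -dvdn_divisors //; apply/idP/mapP.
  case/andP=> /andP[/dvdnP[f ->] qf] fd; exists f; last by rewrite mulnC.
  rewrite mem_filter -dvdn_divisors // (dvdn_trans _ fd) ?dvdn_mulr // andbT.
  by apply: contra qf => qf; rewrite mulnC expnS expn1 dvdn_pmul2l.
case=> f; rewrite mem_filter -dvdn_divisors // => /andP[qf fd] ->.
rewrite dvdn_mulr //= expnS expn1 dvdn_pmul2l // qf /=.
by rewrite Gauss_dvd ?qd // prime_coprime.
Qed.

Definition signed_mobius (n e : nat) : int := (-1) ^+ (n + n %/ e) * mobius e.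

Lemma sum_signed_mobius (n d : nat) : (0 < n)%N -> (d %| n)%N ->
  \sum_(e <- divisors d) signed_mobius n e = (gcd_weight n d)%:R.
Proof.
move=> n0 dn; have d0 := dvdn_gt0 n0 dn.
have F0 q : prime q -> forall e, (0 < e)%N -> (q ^ 2 %| e)%N -> signed_mobius n e = 0.
  by move=> qP e e0 qe; rewrite /signed_mobius (mobius_sqr qP) ?mulr0.
have F1 : signed_mobius n 1 = 1.
  by rewrite /signed_mobius divn1 mulr1 -signr_odd oddD addbb.
have [/hasP[q] | /hasPn qN] := boolP (has odd (primes d)).
  rewrite mem_primes d0 /= => /andP[qP qd] oq.
  rewrite (sum_divisors_prime qP d0 qd (F0 q qP)) big1_seq => [|e].
    rewrite /gcd_weight; have := dvdn_leq d0 qd; have := prime_gt1 qP.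
    by case: d {dn d0} qd => [|[|[|d]]] //; case: (q) oq => [|[|[|]]].
  rewrite -dvdn_divisors // => /andP[qe ed].
  have e0 := dvdn_gt0 d0 ed.
  have qen : (q * e %| n)%N.
    by apply: dvdn_trans dn; rewrite Gauss_dvd ?qd // prime_coprime.
  rewrite /signed_mobius mobius_prime_mul // mulrN.
  have /dvdnP[f nE] := qen.
  have -> : (n %/ e = f * q)%N by rewrite nE mulnA mulnK.
  have -> : (n %/ (q * e) = f)%N by rewrite nE mulnK // muln_gt0 prime_gt0.
  rewrite -signr_odd -[X in _ - X * _]signr_odd !oddD oddM oq andbT.
  by rewrite subrr.
have [d1 | d1] := eqVneq d 1%N.
  by rewrite d1 big_seq1 F1.
have d_even : (2 %| d)%N.
  have dgt1 : (1 < d)%N by lia.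
  have := pdiv_dvd d; have [->//|o2] := even_prime (pdiv_prime dgt1).
  by have := qN (pdiv d); rewrite mem_primes pdiv_prime // pdiv_dvd d0 => /(_ isT); rewrite o2.
rewrite (sum_divisors_prime _ d0 d_even (F0 2%N _)) //.
have -> : \sum_(e <- divisors d | ~~ (2 %| e)%N)
    (signed_mobius n e + signed_mobius n (2 * e)) = 1 + signed_mobius n 2.
  rewrite -big_filter (bigD1_seq 1%N) ?mem_filter ?filter_uniq ?divisors_uniq //=;
    last by rewrite -dvdn_divisors.
  rewrite F1 muln1 big1_seq ?addr0 // => e; rewrite mem_filter -dvdn_divisors //.
  case/and3P=> e1 e2 ed; have egt1 : (1 < e)%N by have := dvdn_gt0 d0 ed; lia.
  have := qN (pdiv e); rewrite mem_primes pdiv_prime // d0.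
  rewrite (dvdn_trans (pdiv_dvd e) ed) => /(_ isT).
  have [p2 | -> //] := even_prime (pdiv_prime egt1).
  by rewrite -p2 pdiv_dvd in e2.
have nE : (n = n %/ 2 * 2)%N by rewrite divnK // (dvdn_trans d_even).
have -> : signed_mobius n 2 = - (-1) ^+ (n %/ 2).
  rewrite /signed_mobius (_ : mobius 2 = -1) // mulrN1; congr (- _).
  by rewrite exprD -[X in X * _]signr_odd {1}nE oddM andbF mul1r.
rewrite /gcd_weight (negPf d1) -signr_odd.
case: (boolP (odd (n %/ 2))) => on /=.
  have n4 : n == 2 %[mod 4] by lia.
  have -> : d = 2%N; last by rewrite eqxx n4.
  apply/eqP/negPn/negP => d2; have /dvdnP[f fE] := d_even.
  have fgt1 : (1 < f)%N by lia.
  have fd : (f %| d)%N by rewrite fE dvdn_mulr.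
  have := qN (pdiv f); rewrite mem_primes pdiv_prime // d0.
  rewrite (dvdn_trans (pdiv_dvd f) fd) => /(_ isT).
  have [p2 _ | -> //] := even_prime (pdiv_prime fgt1).
  have : (2 * 2 %| n)%N by apply: dvdn_trans dn; rewrite fE dvdn_pmul2r // -p2 pdiv_dvd.
  lia.
have -> : (n == 2 %[mod 4]) = false by lia.
by rewrite andbF expr0 subrr.
Qed.

Lemma perm_divisors_codiv (n : nat) : (0 < n)%N ->
  perm_eq (divisors n) [seq (n %/ d)%N | d <- divisors n].
Proof.
move=> n0; have K d : (d %| n)%N -> (n %/ (n %/ d))%N = d.
  by move=> dn; rewrite divnA // mulKn.
apply: uniq_perm; rewrite ?divisors_uniq //.
  rewrite map_inj_in_uniq ?divisors_uniq // => a b.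
  rewrite -!dvdn_divisors // => an bn ab.
  by rewrite -(K a an) ab K.
move=> e; rewrite -dvdn_divisors //; apply/idP/mapP => [en | [d]].
  exists (n %/ e)%N; first by rewrite -dvdn_divisors // dvdn_div.
  by rewrite K.
by rewrite -dvdn_divisors // => dn ->; apply: dvdn_div.
Qed.

Lemma num_orbits_sum (m : nat) :
  (num_orbits m 1)%:R * m.+1%:R ^+ 2 =
  \sum_(e <- divisors m.+1) signed_mobius m.+1 e *
     'C(2 * (m.+1 %/ e) - 1, m.+1 %/ e)%:R :> int.
Proof.
apply: (@mulIf _ (m.+1`!)%:R); first by rewrite pnatr_eq0 -lt0n fact_gt0.
rewrite big_distrl /= -!natrX -!natrM mulnAC num_orbits_Burnside.
rewrite mulnC -mulnn -mulnA !big_distrr /=.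
rewrite (eq_bigr (fun p : 'S_m.+1 =>
  gcd_weight m.+1 (cycle_gcd p) * m.+1 ^ #|porbits p|)%N); last first.
  by move=> p _; rewrite chi_gcd_weight.
rewrite natr_sum.
transitivity (\sum_(p : 'S_m.+1)
    \sum_(e <- divisors m.+1 | (e %| cycle_gcd p)%N)
       signed_mobius m.+1 e * (m.+1 ^ #|porbits p|)%:R).
  apply: eq_bigr => p _; have dn := cycle_gcd_dvd p.
  rewrite natrM -(sum_signed_mobius (ltn0Sn m) dn) big_distrl /=.
  rewrite -[RHS]big_filter; apply: perm_big; apply: uniq_perm.
  - exact: divisors_uniq.
  - by rewrite filter_uniq ?divisors_uniq.
  move=> e; rewrite mem_filter -!dvdn_divisors ?(dvdn_gt0 _ dn) //.
  by case: (boolP (e %| cycle_gcd p)%N) => // /dvdn_trans->.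
rewrite (exchange_big_dep xpredT) //= !big_seq; apply: eq_bigr => e.
rewrite -dvdn_divisors // => en.
rewrite -mulrA -natrM -(@sum_expn_porbits m e (m.+1 %/ e)); last first.
  by rewrite mulnC divnK.
by rewrite natr_sum big_distrr.
Qed.

Theorem theorem3p2 (m : nat) :
  let n := m.+1 in
  (forall p : 'S_n,
     let lam := cycle_type p in
     let l := size lam in
     let d := \big[gcdn/0%N]_(k <- lam) k in
     (chi 1 p)%:R =
       (if d == 1%N then n%:R ^ (l%:Z - 2)
        else if (d == 2%N) && (n == 2 %[mod 4]) then 2 * n%:R ^ (l%:Z - 2)
        else 0) :> rat)
  /\ (num_orbits m 1)%:R =
       (n%:R ^+ 2)^-1 *
       \sum_(d <- divisors n)
          (-1) ^+ (n + d) * (mobius (n %/ d))%:~R * 'C(2 * d - 1, d)%:R :> rat.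
Proof.
move=> n; have n0 : n%:R != 0 :> rat by rewrite pnatr_eq0.
split=> [p lam l d | ].
  have -> : (chi 1 p)%:R = (gcd_weight n d)%:R * n%:R ^ (l%:Z - 2) :> rat.
    apply: (mulfI n0); apply: (mulfI n0); rewrite -!natrM chi_gcd_weight.
    have -> : n%:R ^ (l%:Z - 2) = n%:R ^+ l / n%:R ^+ 2 :> rat.
      by rewrite expfzDr.
    rewrite -size_cycle_type natrM natrX [RHS]mulrA -expr2 mulrCA; congr (_ * _).
    by rewrite mulrC divfK ?expf_neq0.
  rewrite /gcd_weight; case: ifP => _; first by rewrite mul1r.
  by case: ifP => _; rewrite ?mul0r.
apply: (mulfI (expf_neq0 2 n0)); rewrite mulVKf ?expf_neq0 //.
rewrite mulrC; have /(congr1 (intmul (1 : rat))) := num_orbits_sum m.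
rewrite rmorphM rmorphXn /= !rmorph_nat => ->.
rewrite rmorph_sum (perm_big _ (perm_divisors_codiv (ltn0Sn m))) big_map.
rewrite !big_seq; apply: eq_bigr => d; rewrite -dvdn_divisors // => dn.
rewrite divnA // mulKn // /signed_mobius divnA // mulKn //.
by rewrite !rmorphM rmorphXn rmorphN1 /= rmorph_nat.
Qed.
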